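(* Let $d$ be a thin dimension vector with $e(d)=1$. Let $J=J(d)$, $K=\operatorname{supp} d\setminus J$, $T=\Delta(J)$ and $S=\Delta(K)$. Then: (a) $\mathrm{Ext}^1_{\mathcal A_{t,1}}(T,S)\cong k$ and $\mathrm{Ext}^1_{\mathcal A_{t,1}}(S,T)=0$. (b) If $0\to S\to M\to T\to 0$ is a non-split short exact sequence of $\mathcal A_{t,1}$-modules (such $M$ is unique up to isomorphism), then $\mathrm{Ext}^1_{\mathcal A_{t,1}}(M,M)=0$.
   Context: Let $k$ be an algebraically closed field. A thin dimension vector is $d=(d_1,\dots,d_t)\in\{0,1\}^t$ with $d_1=d_t=1$ and no two consecutive entries equal to $0$; $\operatorname{supp} d=\{i: d_i=1\}$. Write its entries as maximal strings of consecutive ones of lengths $a_0,a_1,\dots,a_{r+1}$ (in order, separated by single zeros); the strings of lengths $a_1,\dots,a_r$ are called internal, and $e(d)=\#\{1\le i\le r: a_i\text{ even}\}$. Let $b_1<\dots<b_{e(d)}$ be the positions of the last entries of the internal strings of even length. Define $J(d)$ as the set of $j\in\{1,\dots,t\}$ such that either $j\le b_1-1$ and $j\equiv b_1-1\pmod 2$; or $b_i+2\le j\le b_{i+1}-1$ and $j\equiv b_i \pmod 2$ for some $1\le i<e(d)$; or $j\ge b_{e(d)}+2$ and $j\equiv b_{e(d)}\pmod 2$. $\mathcal A_{t,1}$ is the quotient of the path algebra over $k$ of the quiver with vertices $1,\dots,t$, arrows $\alpha_i:i\to i+1$ ($1\le i\le t-1$) and $\beta_j:j+2\to j$ ($1\le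 j\le t-2$), by the relations $\beta_1\alpha_2=0$ and $\beta_{i+1}\alpha_{i+2}=\alpha_i\beta_i$ for $1\le i\le t-3$ (compositions right to left); modules are representations satisfying these relations. A subset $J\subseteq\{1,\dots,t\}$ is standard if $j\in J\Rightarrow j+1\notin J$. For nonempty standard $J$, $\Delta(J)_i=k^{l}$ with $l=\#\{j\in J: j\le i\}$ and basis $e_1,\dots,e_l$; $\alpha_i$ is the inclusion $e_h\mapsto e_h$, and $\beta_j(e_h)=e_{h-1}$ for $h\ge 2$, $\beta_j(e_1)=0$. *)

(* Defs.v *)
From HB Require Import structures.
From mathcomp Require Import all_boot all_algebra.
Set Implicit Arguments. Unset Strict Implicit. Unset Printing Implicit Defensive.
Import GRing.Theory.
Local Open Scope ring_scope.

(* Vertices are the naturals 1..t; a representation assigns to every  *)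
(* natural i a space k^(rdim i) (required to be 0 outside 1..t), and  *)
(* matrices for alpha_i : i -> i+1 and beta_j : j+2 -> j.             *)
(* Convention: linear maps act on ROW vectors, v |-> v *m A, so the   *)
(* composite "g after f" has matrix A_f *m A_g.                       *)
Record rep (k : fieldType) := Rep {
  rdim : nat -> nat;
  ralpha : forall i, 'M[k]_(rdim i, rdim i.+1);
  rbeta : forall j, 'M[k]_(rdim j.+2, rdim j) }.

Definition is_rep (k : fieldType) (t : nat) (X : rep k) : Prop :=
  rdim X 0 = 0%N /\ (forall i, (t < i)%N -> rdim X i = 0%N).

Definition is_module (k : fieldType) (t : nat) (X : rep k) : Prop :=
  [/\ is_rep t X,
      (3 <= t)%N -> (ralpha X 2 *m rbeta X 1 = 0)%R &
      forall i, (1 <= i)%N -> (i + 3 <= t)%N ->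
        ralpha X i.+2 *m rbeta X i.+1 = rbeta X i *m ralpha X i].

Definition is_hom (k : fieldType) (X Y : rep k)
    (h : forall i, 'M[k]_(rdim X i, rdim Y i)) : Prop :=
  (forall i, ralpha X i *m h i.+1 = h i *m ralpha Y i) /\
  (forall j, rbeta X j *m h j = h j.+2 *m rbeta Y j).

(* Ext^1(X, Y), as Yoneda extensions 0 -> Y -> E -> X -> 0.           *)
(* Every such extension is, vertexwise, E_i = Y_i (+) X_i with arrows *)
(* given by block-triangular matrices; it is determined by the        *)
(* off-diagonal data (fa, fb).                                        *)
Definition ext_rep (k : fieldType) (X Y : rep k)
    (fa : forall i, 'M[k]_(rdim X i, rdim Y i.+1))
    (fb : forall j, 'M[k]_(rdim X j.+2, rdim Y j)) : rep k :=
  @Rep k (fun i => rdim Y i + rdim X i)%N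
    (fun i => block_mx (ralpha Y i) 0 (fa i) (ralpha X i))
    (fun j => block_mx (rbeta Y j) 0 (fb j) (rbeta X j)).

Definition ext_cocycle (k : fieldType) (t : nat) (X Y : rep k)
    (fa : forall i, 'M[k]_(rdim X i, rdim Y i.+1))
    (fb : forall j, 'M[k]_(rdim X j.+2, rdim Y j)) : Prop :=
  is_module t (ext_rep fa fb).

Definition ext_coboundary (k : fieldType) (X Y : rep k)
    (fa : forall i, 'M[k]_(rdim X i, rdim Y i.+1))
    (fb : forall j, 'M[k]_(rdim X j.+2, rdim Y j)) : Prop :=
  exists h : forall i, 'M[k]_(rdim X i, rdim Y i),
    (forall i, fa i = (h i *m ralpha Y i - ralpha X i *m h i.+1)%R) /\
    (forall j, fb j = (h j.+2 *m rbeta Y j - rbeta X j *m h j)%R).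

Definition Ext1_zero (k : fieldType) (t : nat) (X Y : rep k) : Prop :=
  forall fa fb, @ext_cocycle k t X Y fa fb -> ext_coboundary fa fb.

(* Ext^1(X, Y) ~= k : the quotient (cocycles / coboundaries) is spanned by
   one nonzero class. *)
Definition Ext1_iso_k (k : fieldType) (t : nat) (X Y : rep k) : Prop :=
  exists fa fb, [/\ @ext_cocycle k t X Y fa fb, ~ ext_coboundary fa fb &
    forall ga gb, @ext_cocycle k t X Y ga gb ->
      exists c : k, ext_coboundary (fun i => (ga i - c *: fa i)%R)
                                   (fun j => (gb j - c *: fb j)%R)].

Definition ses (k : fieldType) (S M T : rep k)
    (f : forall i, 'M[k]_(rdim S i, rdim M i))
    (g : forall i, 'M[k]_(rdim M i, rdim T i)) : Prop :=
  [/\ is_hom f, is_hom g &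
      forall i, [/\ row_free (f i), row_full (g i) & (f i == kermx (g i))%MS]].

Definition ses_split (k : fieldType) (S M T : rep k)
    (g : forall i, 'M[k]_(rdim M i, rdim T i)) : Prop :=
  exists s : forall i, 'M[k]_(rdim T i, rdim M i),
    is_hom s /\ forall i, s i *m g i = 1%:M.

Definition delta_dim (t : nat) (J : pred nat) (i : nat) : nat :=
  if (1 <= i <= t)%N then count J (iota 1 i) else 0%N.

Definition Delta (k : fieldType) (t : nat) (J : pred nat) : rep k :=
  @Rep k (delta_dim t J)
    (fun i => \matrix_(a < delta_dim t J i, b < delta_dim t J i.+1)
                 ((a : nat) == b)%:R)
    (fun j => \matrix_(a < delta_dim t J j.+2, b < delta_dim t J j)
                 ((a : nat) == b.+1)%:R).

(* Thin dimension vectors d = (d_1, ..., d_t), encoded as a seq bool   *)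
(* of length t; dv d i = d_i for 1 <= i <= t, false otherwise.         *)
Definition dv (d : seq bool) (i : nat) : bool := (0 < i)%N && nth false d i.-1.

Definition thin (d : seq bool) : bool :=
  [&& (0 < size d)%N, dv d 1, dv d (size d) &
      all (fun i => dv d i || dv d i.+1) (iota 1 (size d).-1)].

Definition supp (d : seq bool) : pred nat := fun i => dv d i.

(* b is the last position of an internal string of ones of even length:
   the string [a..b] is preceded by a zero (a > 1) and followed by a
   zero (b < t), and has length b - a + 1 even. *)
Definition even_end (d : seq bool) (b : nat) : bool :=
  [&& (1 <= b)%N, (b < size d)%N, dv d b, ~~ dv d b.+1 &
      has (fun a => [&& (1 < a)%N, (a <= b)%N, ~~ dv d a.-1,
                        all (dv d) (iota a (b - a).+1) & odd (b - a)])
          (iota 0 b.+1)].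

Definition bpos (d : seq bool) : seq nat := filter (even_end d) (iota 1 (size d)).

Definition e_of (d : seq bool) : nat := size (bpos d).

Definition J_of (d : seq bool) : pred nat := fun j =>
  let bb := bpos d in let e := size bb in
  [&& (1 <= j)%N, (j <= size d)%N &
   [|| [&& (0 < e)%N, (j <= (nth 0 bb 0).-1)%N & odd j == odd (nth 0 bb 0).-1],
       has (fun i => [&& (nth 0 bb i + 2 <= j)%N, (j <= (nth 0 bb i.+1).-1)%N
                         & odd j == odd (nth 0 bb i)]) (iota 0 e.-1)
     | [&& (0 < e)%N, (nth 0 bb e.-1 + 2 <= j)%N & odd j == odd (nth 0 bb e.-1)]]].

Definition K_of (d : seq bool) : pred nat := fun j => supp d j && ~~ J_of d j.

(* Main.v *)
(* A Delta-filtered module is a flag V_1 <= ... <= V_t together with an operator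
   phi with phi(V_i) <= V_(i-2).  Between two such modules, Ext^1 is the cokernel
   of h |-> [h, phi] from filtered maps to maps lowering the filtration by 2.  For
   Delta(J) and Delta(K) this sends the elementary map E_(a,b) to
   E_(a,b-1) - E_(a+1,b), so the pairs (a, b) fall into paths, and every target
   pair adjacent to a source pair on one fixed side can be solved for
   recursively.  This gives Ext(S,T) = Ext(S,S) = Ext(T,T) = 0; for Ext(T,S) the
   single pair (first element of J beyond b_1, b_1) is isolated and accounts for
   the one-dimensional Ext.  In a non-split sequence S -> M -> T the connecting
   map Hom(S,S) -> Ext(T,S) is onto, hence Ext(M,S) = 0; also Ext(M,T) = 0, and
   so Ext(M,M) = 0. *)
Require Import Defs.
From HB Require Import structures.
From mathcomp Require Import all_boot all_algebra.
From mathcomp Require Import zify.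
Set Implicit Arguments. Unset Strict Implicit. Unset Printing Implicit Defensive.
Import GRing.Theory.
Local Open Scope ring_scope.

(** * Cocycles and coboundaries, and their behaviour under homomorphisms *)

Section Cochains.
Variables (k : fieldType) (t : nat).
Implicit Types X Y Z W : rep k.

Definition coba X Y (h : forall i, 'M[k]_(rdim X i, rdim Y i)) i :=
  h i *m ralpha Y i - ralpha X i *m h i.+1.
Definition cobb X Y (h : forall i, 'M[k]_(rdim X i, rdim Y i)) j :=
  h j.+2 *m rbeta Y j - rbeta X j *m h j.

(** The off-diagonal block of the commutation relation in [ext_rep fa fb]. For modules the
    right-hand side at i = 0 passes through zero spaces, so that case carries the relation beta_1
    alpha_2 = 0. *)
Definition cocycle X Y (fa : forall i, 'M[k]_(rdim X i, rdim Y i.+1))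
    (fb : forall j, 'M[k]_(rdim X j.+2, rdim Y j)) : Prop :=
  forall i, (i + 3 <= t)%N ->
    fa i.+2 *m rbeta Y i.+1 + ralpha X i.+2 *m fb i.+1 =
    fb i *m ralpha Y i + rbeta X i *m fa i.

Lemma mulmx_dim0 (m p n : nat) (A : 'M[k]_(m, p)) (B : 'M_(p, n)) :
  p = 0%N -> A *m B = 0.
Proof. by move=> p0; subst p; rewrite thinmx0 mul0mx. Qed.

Lemma eqmx_dim0 (m n : nat) (A B : 'M[k]_(m, n)) : n = 0%N -> A = B.
Proof. by move=> n0; subst n; rewrite !thinmx0. Qed.

(* As X_0 = 0, the relation beta_1 alpha_2 = 0 is the case i = 0 of the
   commutation relation. *)
Lemma is_moduleE X : is_rep t X ->
  is_module t X <-> forall i, (i + 3 <= t)%N ->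
    ralpha X i.+2 *m rbeta X i.+1 = rbeta X i *m ralpha X i.
Proof.
move=> rX; have [X0 _] := rX; split.
  case=> _ H0 H [|i] it; last by apply: H => //; lia.
  by rewrite [RHS]mulmx_dim0 // H0.
move=> H; split=> // [t3|i _]; last exact: H.
by rewrite H // mulmx_dim0.
Qed.

Lemma ext_cocycleE X Y fa fb : is_module t X -> is_module t Y ->
  @ext_cocycle k t X Y fa fb <-> cocycle fa fb.
Proof.
move=> mX mY; have [rX _ _] := mX; have [rY _ _] := mY.
have rE : is_rep t (ext_rep fa fb).
  case: rX rY => [X0 X1] [Y0 Y1]; split=> [|i it] /=; first by rewrite X0 Y0.
  by rewrite X1 ?Y1.
rewrite /ext_cocycle; apply: iff_trans (is_moduleE rE) _.
have {mX} HX := (is_moduleE rX).1 mX; have {mY} HY := (is_moduleE rY).1 mY.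
split=> H i it; move: (H i it) => /=.
  rewrite !mulmx_block !(mul0mx, mulmx0, addr0, add0r).
  by case/eq_block_mx.
by move=> E; rewrite !mulmx_block !(mul0mx, mulmx0, addr0, add0r) E HX // HY.
Qed.

Lemma coba_cocycle X Y (h : forall i, 'M[k]_(rdim X i, rdim Y i)) :
  is_module t X -> is_module t Y -> cocycle (coba h) (cobb h).
Proof.
move=> mX mY i it; have [rX _ _] := mX; have [rY _ _] := mY.
have {mX} HX := (is_moduleE rX).1 mX i it.
have {mY} HY := (is_moduleE rY).1 mY i it.
rewrite /coba /cobb !(mulmxBl, mulmxBr) -!mulmxA HY !mulmxA HX.
by rewrite !addrA !subrK.
Qed.

Lemma cocycleB X Y fa fb ga gb : @cocycle X Y fa fb -> @cocycle X Y ga gb ->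
  cocycle (fun i => fa i - ga i) (fun j => fb j - gb j).
Proof.
move=> F G i it; rewrite !(mulmxBl, mulmxBr).
rewrite addrACA -opprD F // G // opprD addrACA //.
Qed.

Lemma coba_mulr X Y Z h (u : forall i, 'M_(rdim Y i, rdim Z i)) : is_hom u ->
  (forall i, @coba X Z (fun i => h i *m u i) i = coba h i *m u i.+1) /\
  (forall j, @cobb X Z (fun i => h i *m u i) j = cobb h j *m u j).
Proof.
by case=> Ha Hb; split=> i; rewrite /coba /cobb mulmxBl -!mulmxA ?Ha ?Hb.
Qed.

Lemma coba_mull W X Y h (u : forall i, 'M_(rdim W i, rdim X i)) : is_hom u ->
  (forall i, @coba W Y (fun i => u i *m h i) i = u i *m coba h i) /\
  (forall j, @cobb W Y (fun i => u i *m h i) j = u j.+2 *m cobb h j).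
Proof.
by case=> Ha Hb; split=> i; rewrite /coba /cobb mulmxBr !mulmxA ?Ha ?Hb.
Qed.

Lemma cobaD X Y (h h' : forall i, 'M[k]_(rdim X i, rdim Y i)) :
  (forall i, coba (fun i => h i + h' i) i = coba h i + coba h' i) /\
  (forall j, cobb (fun i => h i + h' i) j = cobb h j + cobb h' j).
Proof.
by split=> i; rewrite /coba /cobb mulmxDl mulmxDr opprD addrACA.
Qed.

Lemma cobaZ X Y c (h : forall i, 'M[k]_(rdim X i, rdim Y i)) :
  (forall i, coba (fun i => c *: h i) i = c *: coba h i) /\
  (forall j, cobb (fun i => c *: h i) j = c *: cobb h j).
Proof.
by split=> i; rewrite /coba /cobb -scalemxAl -scalemxAr scalerBr.
Qed.

Lemma cocycle_mulr X Y Z fa fb (u : forall i, 'M_(rdim Y i, rdim Z i)) :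
  is_hom u -> @cocycle X Y fa fb ->
  @cocycle X Z (fun i => fa i *m u i.+1) (fun j => fb j *m u j).
Proof.
case=> Ha Hb F i it; move: (congr1 (mulmx^~ (u i.+1)) (F i it)).
by rewrite !mulmxDl -!mulmxA Ha Hb.
Qed.

Lemma cocycle_mulr_inj X Y Z fa fb (u : forall i, 'M_(rdim Y i, rdim Z i)) :
  is_hom u -> (forall i, row_free (u i)) ->
  @cocycle X Z (fun i => fa i *m u i.+1) (fun j => fb j *m u j) ->
  @cocycle X Y fa fb.
Proof.
case=> Ha Hb inj F i it; apply: (row_free_inj (inj i.+1)).
by move: (F i it); rewrite !mulmxDl -!mulmxA Ha Hb.
Qed.

Lemma cocycle_mull W X Y fa fb (u : forall i, 'M_(rdim W i, rdim X i)) :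
  is_hom u -> @cocycle X Y fa fb ->
  @cocycle W Y (fun i => u i *m fa i) (fun j => u j.+2 *m fb j).
Proof.
case=> Ha Hb F i it; move: (congr1 (mulmx (u i.+2)) (F i it)).
by rewrite !mulmxDr !mulmxA -Ha -Hb.
Qed.

Lemma cocycle_mull_surj W X Y fa fb (u : forall i, 'M_(rdim W i, rdim X i)) :
  is_hom u -> (forall i, row_full (u i)) ->
  @cocycle W Y (fun i => u i *m fa i) (fun j => u j.+2 *m fb j) ->
  @cocycle X Y fa fb.
Proof.
case=> Ha Hb surj F i it; apply: (row_full_inj (surj i.+2)).
by move: (F i it); rewrite !mulmxDr !mulmxA -Ha -Hb.
Qed.

Lemma Ext1_zeroE X Y : is_module t X -> is_module t Y ->
  Ext1_zero t X Y <-> forall fa fb, @cocycle X Y fa fb -> ext_coboundary fa fb.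
Proof.
by move=> mX mY; split=> H fa fb /(ext_cocycleE _ _ mX mY); apply: H.
Qed.

End Cochains.

(** * Vertexwise factorization through kernels and cokernels *)

Section Exactness.
Variables (k : fieldType) (m n p : nat) (f : 'M[k]_(m, n)) (g : 'M[k]_(n, p)).
Hypotheses (fg : (f == kermx g)%MS).

Lemma exact_mul0 : f *m g = 0.
Proof. by apply/sub_kermxP; case/andP: fg. Qed.

Lemma exact_factorl q (A : 'M_(q, n)) : A *m g = 0 -> A = A *m pinvmx f *m f.
Proof.
move/sub_kermxP=> Ag; rewrite mulmxKpV //.
by case/andP: fg => _; apply: submx_trans.
Qed.

Lemma exact_factorr q (A : 'M_(n, q)) :
  row_full g -> f *m A = 0 -> A = g *m (pinvmx g *m A).
Proof.
move=> gfull fA; apply/eqP; rewrite -subr_eq0; apply/eqP.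
rewrite mulmxA -{1}[A]mul1mx -mulmxBl.
have /exact_factorl-> : (1%:M - g *m pinvmx g) *m g = 0.
  by rewrite mulmxBl mul1mx -mulmxA mulVpmx // mulmx1 subrr.
by rewrite -!mulmxA fA !mulmx0.
Qed.

End Exactness.

(** * Exactness of Ext^1 along 0 -> S -> M -> T -> 0 *)

Section HalfExactness.
Variables (k : fieldType) (t : nat) (S M T : rep k).
Variables (f : forall i, 'M[k]_(rdim S i, rdim M i)).
Variables (g : forall i, 'M[k]_(rdim M i, rdim T i)).
Hypotheses (mS : is_module t S) (mM : is_module t M) (mT : is_module t T).
Hypothesis fgM : ses f g.

(** Pushed to T, the cocycle is the coboundary of some h. A linear lift of h through g, in general
    no homomorphism, corrects the cocycle to one with values in S, which is killed in turn. *)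
Lemma Ext1_zero_ses_r X : is_module t X ->
  Ext1_zero t X S -> Ext1_zero t X T -> Ext1_zero t X M.
Proof.
move=> mX /(Ext1_zeroE mX mS) zS /(Ext1_zeroE mX mT) zT.
apply/(Ext1_zeroE mX mM) => fa fb F; have [hf hg H] := fgM.
have [h [ha hb]] := zT _ _ (cocycle_mulr hg F).
pose h' i := h i *m pinvmx (g i).
have h'g i : h' i *m g i = h i.
  by case: (H i) => _ gi _; rewrite -mulmxA mulVpmx // mulmx1.
have [qa qb] := coba_mulr h' hg.
pose ga i := fa i - coba h' i; pose gb j := fb j - cobb h' j.
have ga0 i : ga i *m g i.+1 = 0.
  by rewrite mulmxBl ha -qa /coba !h'g subrr.
have gb0 j : gb j *m g j = 0.
  by rewrite mulmxBl hb -qb /cobb !h'g subrr.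
have Ga i : ga i = ga i *m pinvmx (f i.+1) *m f i.+1.
  by case: (H i.+1) => _ _ /exact_factorl; apply.
have Gb j : gb j = gb j *m pinvmx (f j) *m f j.
  by case: (H j) => _ _ /exact_factorl; apply.
have G : cocycle t ga gb by apply: cocycleB => //; apply: coba_cocycle.
have [|u [ua ub]] := zS (fun i => ga i *m pinvmx (f i.+1)) (fun j => gb j *m pinvmx (f j)).
  apply: (cocycle_mulr_inj hf) => [i|i it]; first by case: (H i).
  by rewrite -!Ga -!Gb; apply: G.
have [ra rb] := coba_mulr u hf.
exists (fun i => u i *m f i + h' i).
have [da db] := cobaD (fun i => u i *m f i) h'.
split=> i.
  by rewrite [RHS]da ra [coba u i]/coba -ua -Ga subrK.
by rewrite [RHS]db rb [cobb u i]/cobb -ub -Gb subrK.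
Qed.

Lemma cocycle_descend X ga gb : @cocycle k t M X ga gb ->
    (forall i, f i *m ga i = 0) -> (forall j, f j.+2 *m gb j = 0) ->
  exists fa fb, [/\ @cocycle k t T X fa fb,
    forall i, ga i = g i *m fa i & forall j, gb j = g j.+2 *m fb j].
Proof.
have [hf hg H] := fgM => G ga0 gb0.
have Ga i : ga i = g i *m (pinvmx (g i) *m ga i).
  by case: (H i) => _ gi fgi; apply: (exact_factorr fgi).
have Gb j : gb j = g j.+2 *m (pinvmx (g j.+2) *m gb j).
  by case: (H j.+2) => _ gi fgi; apply: (exact_factorr fgi).
exists (fun i => pinvmx (g i) *m ga i), (fun j => pinvmx (g j.+2) *m gb j).
split=> //; apply: (cocycle_mull_surj hg) => [i|i it]; first by case: (H i).
by rewrite -!Ga -!Gb; apply: G.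
Qed.

(** On S the cocycle is the coboundary of some h. Extending h to M along the linear retractions
    [pinvmx (f i)] and subtracting leaves a cocycle that vanishes on S, hence descends to T. *)
Lemma cocycle_from_quotient X fa fb : is_module t X ->
  Ext1_zero t S X -> @cocycle k t M X fa fb ->
  exists h ga gb, [/\ @cocycle k t T X ga gb,
    forall i, fa i - coba h i = g i *m ga i
  & forall j, fb j - cobb h j = g j.+2 *m gb j].
Proof.
move=> mX /(Ext1_zeroE mS mX) zS F; have [hf hg H] := fgM.
have [h [ha hb]] := zS _ _ (cocycle_mull hf F).
pose h' i := pinvmx (f i) *m h i.
have fh' i : f i *m h' i = h i.
  by case: (H i) => fi _ _; rewrite mulmxA mulmxVp // mul1mx.
have [qa qb] := coba_mull h' hf.
exists h'; apply: cocycle_descend => [|i|j].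
- by apply: cocycleB => //; apply: coba_cocycle.
- by rewrite mulmxBr ha -qa /coba !fh' subrr.
- by rewrite mulmxBr hb -qb /cobb !fh' subrr.
Qed.

Lemma Ext1_zero_ses_l X : is_module t X ->
  Ext1_zero t S X -> Ext1_zero t T X -> Ext1_zero t M X.
Proof.
move=> mX zS /(Ext1_zeroE mT mX) zT; apply/(Ext1_zeroE mM mX) => fa fb F.
have [h [ga [gb [G Ga Gb]]]] := cocycle_from_quotient mX zS F.
have [u [ua ub]] := zT _ _ G; have [_ hg _] := fgM.
have [ra rb] := coba_mull u hg.
exists (fun i => g i *m u i + h i).
have [da db] := cobaD (fun i => g i *m u i) h.
split=> i; first by rewrite [RHS]da ra [coba u i]/coba -ua -Ga subrK.
by rewrite [RHS]db rb [cobb u i]/cobb -ub -Gb subrK.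
Qed.

Lemma Ext1_zero_connecting :
  Ext1_iso_k t T S -> Ext1_zero t S S -> ~ ses_split S g -> Ext1_zero t M S.
Proof.
move=> [ea [eb [_ _ spanE]]] eS nsplit.
apply/(Ext1_zeroE mM mS) => fa fb F; have [hf hg H] := fgM.
pose r i := pinvmx (f i).
have fr i : f i *m r i = 1%:M by case: (H i) => fi _ _; apply: mulmxVp.
have span ga gb : @cocycle k t T S ga gb -> exists c : k,
    ext_coboundary (fun i => ga i - c *: ea i) (fun j => gb j - c *: eb j).
  by move/(ext_cocycleE _ _ mT mS); apply: spanE.
have [frA frB] := coba_mull r hf.
(* The coboundary of the linear retraction r vanishes on S and descends to T. The result x is, up to
   sign, the class of the sequence: the image of id_S under the connecting map. *)
have [xa [xb [X rxa rxb]]] : exists xa xb, [/\ @cocycle k t T S xa xb,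
    forall i, coba r i = g i *m xa i & forall j, cobb r j = g j.+2 *m xb j].
  apply: cocycle_descend => [|i|j]; first exact: coba_cocycle.
    by rewrite -frA /coba !fr mulmx1 mul1mx subrr.
  by rewrite -frB /cobb !fr mulmx1 mul1mx subrr.
(* If x were the coboundary of u, then [v = r - g *m u] would be a homomorphism retracting f;
   [1 - v *m f] vanishes on S, and its factor through g is a section of g. *)
have xN : ~ ext_coboundary xa xb.
  move=> [u [ua ub]]; apply: nsplit.
  have [guA guB] := coba_mull u hg.
  pose w i := g i *m u i; pose v i := r i + -1 *: w i.
  have [vDa vDb] := cobaD r (fun i => -1 *: w i).
  have [vZa vZb] := cobaZ (-1) w.
  have fv i : f i *m v i = 1%:M.
    case: (H i) => _ _ /exact_mul0 fg0.
    by rewrite mulmxDr -scalemxAr fr mulmxA fg0 mul0mx scaler0 addr0.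
  have va i : ralpha M i *m v i.+1 = v i *m ralpha S i.
    apply/esym/eqP; rewrite -subr_eq0; apply/eqP.
    by rewrite [LHS]vDa vZa guA rxa ua scaleN1r subrr.
  have vb j : rbeta M j *m v j = v j.+2 *m rbeta S j.
    apply/esym/eqP; rewrite -subr_eq0; apply/eqP.
    by rewrite [LHS]vDb vZb guB rxb ub scaleN1r subrr.
  have gs i : 1%:M - v i *m f i = g i *m (pinvmx (g i) *m (1%:M - v i *m f i)).
    case: (H i) => _ gi fgi; apply: (exact_factorr fgi) => //.
    by rewrite mulmxBr mulmxA fv mulmx1 mul1mx subrr.
  exists (fun i => pinvmx (g i) *m (1%:M - v i *m f i)).
  have [[hfa hfb] [hga hgb]] := (hf, hg).
  split=> [|i]; first split=> i.
  - case: (H i) => _ /row_full_inj gi _; apply: gi.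
    rewrite [LHS]mulmxA -hga -[LHS]mulmxA -gs [RHS]mulmxA -gs mulmxBr mulmxBl mulmx1 mul1mx.
    by rewrite mulmxA va -!mulmxA hfa.
  - case: (H i.+2) => _ /row_full_inj gi _; apply: gi.
    rewrite [LHS]mulmxA -hgb -[LHS]mulmxA -gs [RHS]mulmxA -gs mulmxBr mulmxBl mulmx1 mul1mx.
    by rewrite mulmxA vb -!mulmxA hfb.
  case: (H i) => _ /row_full_inj gi /exact_mul0 fg0; apply: gi.
  by rewrite mulmxA -gs mulmxBl -mulmxA fg0 mulmx0 subr0 mul1mx mulmx1.
have [c [y [ya yb]]] := span _ _ X.
have c0 : c != 0.
  apply/eqP=> c0; apply: xN; exists y.
  by split=> i; rewrite -?ya -?yb c0 scale0r subr0.
have [h' [ga [gb [G Ga Gb]]]] := cocycle_from_quotient mS eS F.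
have [b [z [za zb]]] := span _ _ G.
(* Modulo coboundaries the descended cocycle is b times the generator and x is c times it, so it is
   b / c times x; and x pulled back to M is the coboundary of r. *)
pose e := b / c; pose w i := z i + - e *: y i.
have [wDa wDb] := cobaD z (fun i => - e *: y i).
have [wZa wZb] := cobaZ (- e) y.
have [gwA gwB] := coba_mull w hg.
have wa i : ga i = e *: xa i + coba w i.
  rewrite [coba w i]wDa wZa -[coba z i]za -[coba y i]ya scaleNr scalerBr scalerA.
  by rewrite divfK // opprB subrKA addrC subrK.
have wb j : gb j = e *: xb j + cobb w j.
  rewrite [cobb w j]wDb wZb -[cobb z j]zb -[cobb y j]yb scaleNr scalerBr scalerA.
  by rewrite divfK // opprB subrKA addrC subrK.
have [eA eB] := cobaZ e r.
have [sA sB] := cobaD (fun i => e *: r i) (fun i => g i *m w i).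
have [tA tB] := cobaD (fun i => e *: r i + g i *m w i) h'.
exists (fun i => e *: r i + g i *m w i + h' i); split=> i.
  by rewrite [RHS]tA sA eA gwA rxa scalemxAr -mulmxDr -wa -Ga subrK.
by rewrite [RHS]tB sB eB gwB rxb scalemxAr -mulmxDr -wb -Gb subrK.
Qed.

Lemma Ext1_zero_extension :
  Ext1_iso_k t T S -> Ext1_zero t S T -> Ext1_zero t S S -> Ext1_zero t T T ->
  ~ ses_split S g -> Ext1_zero t M M.
Proof.
move=> TS ST SS TT nsplit.
apply: Ext1_zero_ses_r => //; first exact: Ext1_zero_connecting.
exact: Ext1_zero_ses_l.
Qed.
End HalfExactness.

(** * Matrix entries indexed by naturals; products with inclusions and shifts *)

Section Entries.
Variable k : fieldType.

(** The value 0 outside the range makes entries at different vertices comparable: multiplying by an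
    inclusion or a shift just truncates and reindexes. *)
Definition entry m n (A : 'M[k]_(m, n)) (a b : nat) : k :=
  if insub a is Some i then if insub b is Some j then A i j else 0 else 0.

Lemma entryE m n (A : 'M[k]_(m, n)) (i : 'I_m) (j : 'I_n) : entry A i j = A i j.
Proof. by rewrite /entry !valK. Qed.

Lemma entry_out m n (A : 'M[k]_(m, n)) a b : ~~ ((a < m) && (b < n))%N ->
  entry A a b = 0.
Proof.
by rewrite /entry; case: insubP => //= i -> _; case: insubP => //= j ->.
Qed.

Lemma entry_inj m n (A B : 'M[k]_(m, n)) :
  (forall a b, (a < m)%N -> (b < n)%N -> entry A a b = entry B a b) -> A = B.
Proof. by move=> E; apply/matrixP=> i j; rewrite -!entryE E. Qed.

Lemma entry_matrix m n (E : nat -> nat -> k) a b :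
  entry (\matrix_(i < m, j < n) E i j) a b =
  if ((a < m) && (b < n))%N then E a b else 0.
Proof.
case: ifPn => [/andP[am bn]|]; last exact: entry_out.
by rewrite -[a]/(val (Ordinal am)) -[b]/(val (Ordinal bn)) entryE mxE.
Qed.

Lemma entry1 n a b :
  entry (1%:M : 'M[k]_n) a b = if ((a < n) && (b < n))%N then (a == b)%:R else 0.
Proof.
rewrite -(entry_matrix _ _ (fun a b => (a == b)%:R)); congr (entry _ a b).
by apply/matrixP=> i j; rewrite !mxE.
Qed.

Lemma entryD m n (A B : 'M[k]_(m, n)) a b :
  entry (A + B) a b = entry A a b + entry B a b.
Proof.
by rewrite /entry; case: (insub a : option 'I_m) => [i|]; case: (insub b : option 'I_n) => [j|]; rewrite ?mxE ?addr0.
Qed.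

Lemma entryN m n (A : 'M[k]_(m, n)) a b : entry (- A) a b = - entry A a b.
Proof.
by rewrite /entry; case: (insub a : option 'I_m) => [i|]; case: (insub b : option 'I_n) => [j|]; rewrite ?mxE ?oppr0.
Qed.

Lemma entry0 m n a b : entry (0 : 'M[k]_(m, n)) a b = 0.
Proof.
by rewrite /entry; case: (insub a : option 'I_m) => [i|]; case: (insub b : option 'I_n) => [j|]; rewrite ?mxE.
Qed.

Lemma entryM m n p (A : 'M[k]_(m, n)) (B : 'M_(n, p)) a b :
  entry (A *m B) a b = \sum_(c < n) entry A a c * entry B c b.
Proof.
have [|out] := boolP ((a < m) && (b < p))%N; last first.
  rewrite entry_out // big1 // => c _; move: out; rewrite negb_and.
  case/orP=> out; first by rewrite entry_out ?mul0r // negb_and out.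
  by rewrite [X in _ * X]entry_out ?mulr0 // negb_and out orbT.
case/andP=> am bp; rewrite -[a]/(val (Ordinal am)) -[b]/(val (Ordinal bp)).
by rewrite entryE mxE; apply: eq_bigr => c _; rewrite !entryE.
Qed.

Lemma sum_nat_delta n (F : nat -> k) (b : nat) :
  \sum_(c < n) F c * (c == b :> nat)%:R = if (b < n)%N then F b else 0.
Proof.
case: ifPn => [bn|bn].
  rewrite (bigD1 (Ordinal bn)) //= eqxx mulr1 big1 ?addr0 // => c.
  by rewrite -val_eqE /= => /negbTE->; rewrite mulr0.
rewrite big1 // => c _; case: eqP => [E|_]; last by rewrite mulr0.
by rewrite -E ltn_ord in bn.
Qed.

Local Notation incl m n := (\matrix_(a < m, b < n) ((a : nat) == b)%:R : 'M[k]_(m, n)).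
Local Notation shift m n := (\matrix_(a < m, b < n) ((a : nat) == b.+1)%:R : 'M[k]_(m, n)).

Lemma entry_incl m n a b :
  entry (incl m n) a b = if ((a < m) && (b < n))%N then (a == b)%:R else 0.
Proof. exact: (entry_matrix _ _ (fun a b => (a == b)%:R)). Qed.

Lemma entry_shift m n a b :
  entry (shift m n) a b = if ((a < m) && (b < n))%N then (a == b.+1)%:R else 0.
Proof. exact: (entry_matrix _ _ (fun a b => (a == b.+1)%:R)). Qed.

Lemma entry_mul_incl m n p (A : 'M_(m, n)) a b :
  entry (A *m incl n p) a b = if (b < p)%N then entry A a b else 0.
Proof.
rewrite entryM; case: ifPn => [bp|bp]; last first.
  by rewrite big1 // => c _; rewrite [X in _ * X]entry_out ?mulr0 // (negbTE bp) andbF.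
under eq_bigr => c _ do rewrite entry_incl ltn_ord bp /=.
rewrite sum_nat_delta; case: ifPn => // bn.
by rewrite entry_out // (negbTE bn) andbF.
Qed.

Lemma entry_mul_shift m n p (A : 'M_(m, n)) a b :
  entry (A *m shift n p) a b = if (b < p)%N then entry A a b.+1 else 0.
Proof.
rewrite entryM; case: ifPn => [bp|bp]; last first.
  by rewrite big1 // => c _; rewrite [X in _ * X]entry_out ?mulr0 // (negbTE bp) andbF.
under eq_bigr => c _ do rewrite entry_shift ltn_ord bp /=.
rewrite sum_nat_delta; case: ifPn => // bn.
by rewrite entry_out // (negbTE bn) andbF.
Qed.

Lemma entry_incl_mul m n p (A : 'M_(n, p)) a b :
  entry (incl m n *m A) a b = if (a < m)%N then entry A a b else 0.
Proof.
rewrite entryM; case: ifPn => [am|am]; last first.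
  by rewrite big1 // => c _; rewrite entry_out ?mul0r // (negbTE am).
under eq_bigr => c _ do rewrite entry_incl ltn_ord am /= mulrC eq_sym.
rewrite (sum_nat_delta _ (fun c => entry A c b)); case: ifPn => // bn.
by rewrite entry_out // (negbTE bn).
Qed.

Lemma entry_shift_mul m n p (A : 'M_(n, p)) a b :
  entry (shift m n *m A) a b =
  if (a < m)%N then (if a is a'.+1 then entry A a' b else 0) else 0.
Proof.
rewrite entryM; case: ifPn => [am|am]; last first.
  by rewrite big1 // => c _; rewrite entry_out ?mul0r // (negbTE am).
under eq_bigr => c _ do rewrite entry_shift ltn_ord am /= mulrC eq_sym.
case: a am => [|a] am; first by rewrite big1 // => c _; rewrite mulr0.
under eq_bigr => c _ do rewrite eqSS.
rewrite (sum_nat_delta _ (fun c => entry A c b)); case: ifPn => // bn.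
by rewrite entry_out // (negbTE bn).
Qed.

End Entries.

(** * Dimensions of Delta(J) and its module relations *)

Section DeltaDim.
Variables (t : nat) (J : pred nat).
Local Notation dim := (delta_dim t J).

Lemma delta_dim0 : dim 0 = 0%N.
Proof. by []. Qed.

Lemma delta_dim_gt i : (t < i)%N -> dim i = 0%N.
Proof. by rewrite /delta_dim ltnNge => /negbTE->; rewrite andbF. Qed.

Lemma delta_dim_le a i : (a < dim i)%N -> (i <= t)%N.
Proof. by case: (leqP i t) => // /delta_dim_gt->. Qed.

Lemma delta_dimS i : (i < t)%N -> dim i.+1 = (dim i + J i.+1)%N.
Proof.
have E : iota 1 i.+1 = iota 1 i ++ [:: i.+1] by rewrite -[in LHS](addn1 i) iotaD add1n.
move=> it; rewrite /delta_dim E it (ltnW it) count_cat /= addn0.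
by case: i {E} it.
Qed.

Lemma delta_dim_mono i j : (i <= j <= t)%N -> (dim i <= dim j)%N.
Proof.
case/andP; elim: j => [|j IHj]; first by rewrite leqn0 => /eqP->.
rewrite leq_eqVlt => /predU1P[-> //|ij] jt.
by rewrite delta_dimS //; have := IHj ij (ltnW jt); lia.
Qed.

(** With basis vectors numbered from 0, [j.+1] is the vertex where e_a first appears, that is,
    element number a + 1 of J. *)
Lemma delta_dim_jump a i : (i <= t)%N -> (a < dim i)%N ->
  exists2 j, (j < i)%N & [/\ J j.+1, dim j = a & dim j.+1 = a.+1].
Proof.
elim: i => [|i IHi] it; first by rewrite delta_dim0.
rewrite delta_dimS //; have [ai _|ia] := ltnP a (dim i).
  by have [j ji H] := IHi (ltnW it) ai; exists j => //; apply: leqW.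
case Ji: (J i.+1) => H; last by lia.
exists i => //; rewrite delta_dimS // Ji; split=> //; lia.
Qed.

Definition standard := forall j, (0 < j < t)%N -> J j -> ~~ J j.+1.

Lemma delta_dim_standard i : standard -> (i.+2 <= t)%N ->
  (dim i.+2 <= (dim i).+1)%N.
Proof.
move=> std it; have := std i.+1; have := delta_dimS (ltnW it).
have := delta_dimS it.
case: (J i.+1) => [-> -> /(_ it isT)/negbTE->|-> ->]; first lia.
by case: (J _); lia.
Qed.

End DeltaDim.

(** Both sides of the relation are the shift e_a |-> e_(a-1); standardness ensures that the
    composite through V_i loses no basis vector. *)
Lemma Delta_module (k : fieldType) t J : standard t J -> is_module t (Delta k t J).
Proof.
move=> std; have rD : is_rep t (Delta k t J).
  by split=> // i it; apply: delta_dim_gt.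
apply: (is_moduleE rD).2 => i it /=.
apply: entry_inj => a b am bn; rewrite entry_mul_shift entry_mul_incl bn.
rewrite entry_incl entry_shift am /=.
have := @delta_dim_standard t J i std; have := @delta_dimS t J i.+2.
case: eqP => E; do 2 case: ifP => //=; lia.
Qed.

(** * Ext^1 between Delta(J) and Delta(K) in terms of index pairs *)

Section DeltaExt.
Variables (k : fieldType) (t : nat) (J K : pred nat).
Hypotheses (stdJ : standard t J) (stdK : standard t K).
Local Notation X := (Delta k t J).
Local Notation Y := (Delta k t K).
Local Notation dX := (delta_dim t J).
Local Notation dY := (delta_dim t K).
Local Notation nmx F m n := (\matrix_(a < m, b < n) F (nat_of_ord a) (nat_of_ord b)).

(* The pairs (a, b) for which e_a |-> e_b (both indexed from 0) is compatible
   with the filtrations, [src] without shift and [tgt] with a shift by 2. *)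
Definition src a b :=
  (a < dX t)%N && [forall i : 'I_t.+1, (a < dX i)%N ==> (b < dY i)%N].
Definition tgt a b :=
  (a < dX t)%N && [forall j : 'I_t.-1, (a < dX j.+2)%N ==> (b < dY j)%N].

Lemma srcP a b : reflect
  ((a < dX t)%N /\ forall i, (i <= t)%N -> (a < dX i)%N -> (b < dY i)%N) (src a b).
Proof.
apply: (iffP andP) => [] [at_ H]; split=> //.
  by move=> i it; have /implyP := forallP H (Ordinal (it : (i < t.+1)%N)).
by apply/forallP=> i; apply/implyP; apply: H; rewrite -ltnS.
Qed.

Lemma tgtP a b : reflect
  ((a < dX t)%N /\ forall j, (j.+2 <= t)%N -> (a < dX j.+2)%N -> (b < dY j)%N)
  (tgt a b).
Proof.
apply: (iffP andP) => [] [at_ H]; split=> //.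
  move=> j jt; have jt' : (j < t.-1)%N by lia.
  by have /implyP := forallP H (Ordinal jt').
by apply/forallP=> j; apply/implyP; apply: H; have := ltn_ord j; lia.
Qed.

(** With [src_tgt_prev]: composing a filtered map with the shift on either side lowers the
    filtration by 2, so [dpair H] vanishes off [tgt] for indices in range. *)
Lemma src_tgt_next a b : src a b -> (a.+1 < dX t)%N -> tgt a.+1 b.
Proof.
move=> /srcP[_ H] at_; apply/tgtP; split=> // j jt aj; apply: H; first by lia.
by have := delta_dim_standard stdJ jt; lia.
Qed.

Lemma src_tgt_prev a b : src a b.+1 -> tgt a b.
Proof.
move=> /srcP[at_ H]; apply/tgtP; split=> // j jt aj.
by have := H _ jt aj; have := delta_dim_standard stdK jt; lia.
Qed.

(* The coboundary of the map e_a |-> \sum_b H a b e_b. *)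
Definition dpair (H : nat -> nat -> k) a b :=
  H a b.+1 - (if a is a'.+1 then H a' b else 0).

(** One array H serves all vertices: the alphas are inclusions, and by the support condition
    truncating H cuts off only zeros. *)
Lemma coba_nmx H : (forall a b, ~~ src a b -> H a b = 0) ->
  let h i : 'M_(rdim X i, rdim Y i) := nmx H (dX i) (dY i) in
  (forall i, coba h i = 0) /\
  (forall j, cobb h j = nmx (dpair H) (dX j.+2) (dY j)).
Proof.
move=> H0 h.
have Hout i a b : (i <= t)%N -> (a < dX i)%N -> (dY i <= b)%N -> H a b = 0.
  by move=> it ai bi; apply: H0; apply/srcP=> -[_ /(_ _ it ai)]; lia.
split=> i; apply: entry_inj => a b /= am bn; rewrite entryD entryN.
  have it := delta_dim_le bn.
  rewrite entry_mul_incl entry_incl_mul bn am !entry_matrix am bn /=.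
  have -> : (a < dX i.+1)%N by have := @delta_dim_mono t J i i.+1; lia.
  rewrite entry0; case: ltnP => [_|bi]; first by rewrite subrr.
  by rewrite (Hout i) ?subrr // ltnW.
have it := delta_dim_le am.
rewrite entry_mul_shift entry_shift_mul bn am !entry_matrix am bn /dpair /=.
congr (_ - _).
  by case: ifPn => // bi; rewrite (Hout i.+2) //; lia.
case: a am => // a am; rewrite entry_matrix bn.
by have := delta_dim_standard stdJ it; case: ltnP => //=; lia.
Qed.

(** Commuting with inclusions makes each h_i the restriction of h_t, so H is read off at the last
    vertex. *)
Lemma coba0_nmx h : (forall i, @coba k X Y h i = 0) ->
  exists2 H, (forall a b, ~~ src a b -> H a b = 0) &
    forall i, h i = nmx H (dX i) (dY i).
Proof.
move=> h0.
have step i a b : (i < t)%N -> (a < dX i)%N -> entry (h i.+1) a b = entry (h i) a b.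
  move=> it ai; have := congr1 (fun A => entry A a b) (h0 i).
  rewrite entryD entryN entry_mul_incl entry_incl_mul ai entry0.
  move/eqP; rewrite subr_eq0 => /eqP <-; case: ifPn => //= bi.
  by rewrite entry_out //=; have := @delta_dim_mono t K i i.+1; lia.
have top n i a b : (i <= n <= t)%N -> (a < dX i)%N -> entry (h n) a b = entry (h i) a b.
  case/andP; elim: n => [|n IHn]; first by rewrite leqn0 => /eqP->.
  rewrite leq_eqVlt => /predU1P[-> //|ni] nt ai; rewrite step ?IHn //; first lia.
  by have := @delta_dim_mono t J i n; lia.
exists (fun a b => entry (h t) a b) => [a b|i].
  apply: contraNeq => h_ab; have /andP[/= at_ bt] : (a < rdim X t)%N && (b < rdim Y t)%N.
    by apply: contraNT h_ab => /entry_out ->.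
  apply/srcP; split=> // i it ai; apply: contraNT h_ab => bi.
  by rewrite (top t i) ?it //= entry_out // negb_and bi orbT.
apply: entry_inj => a b /= am bn; rewrite entry_matrix am bn (top t i) //.
by rewrite (delta_dim_le am) /=.
Qed.

(** For i < t the map alpha_i of X is injective, so h_(i+1) can be prescribed on its image, starting
    from h_0 = 0; for i >= t the target Y_(i+1) is zero. *)
Lemma coba_surj fa : exists h, forall i, fa i = @coba k X Y h i.
Proof.
pose h := nat_rect (fun i => 'M[k]_(rdim X i, rdim Y i)) 0
  (fun i hi => pinvmx (ralpha X i) *m (hi *m ralpha Y i - fa i)).
exists h => i; have [it|it] := ltnP i t; last first.
  by apply: eqmx_dim0; apply: delta_dim_gt.
have free : row_free (ralpha X i).
  apply/row_freeP; exists (\matrix_(a, b) ((a : nat) == b)%:R).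
  apply: entry_inj => a b /= am bn; rewrite entry_mul_incl bn entry_incl am /=.
  have -> : (b < dX i.+1)%N by have := @delta_dim_mono t J i i.+1; lia.
  by rewrite entry1 am bn.
by rewrite /coba /= mulmxA mulmxVp // mul1mx subKr.
Qed.

(** Once fa is removed, the cocycle condition says that the rest of fb commutes with the inclusions,
    so it is cut out of one array F, read off at j = t - 2. *)
Lemma cocycle_nf fa fb : @cocycle k t X Y fa fb -> exists h F,
  [/\ forall i, fa i = coba h i,
      forall j, fb j = cobb h j + nmx F (dX j.+2) (dY j) &
      forall a b, ~~ tgt a b -> F a b = 0].
Proof.
move=> cF; have [h ha] := coba_surj fa.
pose g j := fb j - cobb h j.
have cG : cocycle t (fun i => fa i - coba h i) g.
  by apply: cocycleB => //; apply: coba_cocycle; apply: Delta_module.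
have step j a b : (j + 3 <= t)%N -> (a < dX j.+2)%N -> entry (g j.+1) a b = entry (g j) a b.
  move=> jt aj; have := congr1 (fun A => entry A a b) (cG j jt).
  rewrite !ha !subrr mul0mx mulmx0 add0r addr0 entry_mul_incl entry_incl_mul aj => ->.
  case: ifPn => //= bi.
  by rewrite entry_out //=; have := @delta_dim_mono t K j j.+1; lia.
have top n j a b : (j <= n)%N -> (n.+2 <= t)%N -> (a < dX j.+2)%N ->
    entry (g n) a b = entry (g j) a b.
  elim: n => [|n IHn]; first by rewrite leqn0 => /eqP->.
  rewrite leq_eqVlt => /predU1P[-> //|jn] nt aj; rewrite step ?IHn //; try lia.
  by have := @delta_dim_mono t J j.+2 n.+2; lia.
(* For t < 2 the truncated [t.-2.+2] is not t; all the beta blocks are then empty, and F = 0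
   serves. *)
pose F a b := if (t < 2)%N then 0 else entry (g t.-2) a b.
exists h, F; split=> // [j|a b].
  apply/eqP; rewrite addrC -subr_eq; apply/eqP; apply: entry_inj => a b /= am bn.
  rewrite entry_matrix am bn /F /= -/(g j).
  have jt := delta_dim_le am.
  by rewrite ltnNge (leq_trans _ jt) // (top t.-2 j) //; lia.
rewrite /F; case: ltnP => // t2; apply: contraNeq => g_ab.
have /andP[/= at_ bt] : (a < rdim X t.-2.+2)%N && (b < rdim Y t.-2)%N.
  by apply: contraNT g_ab => /entry_out ->.
have Et : t.-2.+2 = t by lia.
apply/tgtP; split=> [|j jt aj]; first by rewrite Et in at_.
apply: contraNT g_ab => bj; rewrite (top t.-2 j) //; try lia.
by rewrite entry_out // negb_and bj orbT.
Qed.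

Lemma cocycle_nmx F : (forall a b, ~~ tgt a b -> F a b = 0) ->
  @cocycle k t X Y (fun=> 0) (fun j => nmx F (dX j.+2) (dY j)).
Proof.
move=> F0 i it; rewrite mul0mx mulmx0 add0r addr0; apply: entry_inj => a b /= am bn.
rewrite entry_mul_incl entry_incl_mul !entry_matrix am bn /=.
have -> /= : (a < dX i.+3)%N by have := @delta_dim_mono t J i.+2 i.+3; lia.
case: ltnP => // bi; apply: F0; apply/tgtP => -[_ /(_ i)]; lia.
Qed.

(* Solves F = dpair H by decreasing recursion on the first index: [H a b] is
   read off from the equation at [(a.+1, b)]. *)
Lemma dpair_solve_up F : (forall a b, ~~ tgt a b -> F a b = 0) ->
  exists2 H, (forall a b, ~~ src a b -> H a b = 0) &
    forall a b, (0 < a)%N && src a.-1 b || ~~ tgt a b -> F a b = dpair H a b.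
Proof.
move=> F0.
(* The recursion runs on [dX t - a], which is 0 once a is out of range, where H is 0. *)
pose R := nat_rect (fun=> nat -> nat -> k) (fun _ _ => 0)
  (fun _ r a b => if src a b then r a.+1 b.+1 - F a.+1 b else 0).
pose H a b := R (dX t - a)%N a b.
have HE a b : H a b = if src a b then H a.+1 b.+1 - F a.+1 b else 0.
  rewrite /H; case: (ltnP a (dX t)) => at_.
    by have -> : (dX t - a = (dX t - a.+1).+1)%N by lia.
  have -> : (dX t - a = 0)%N by lia.
  by case: srcP => // -[]; lia.
exists H => [a b /negbTE s|a b]; first by rewrite HE s.
rewrite /dpair; case: a => [|a] /=.
  move=> nt; rewrite F0 // HE subr0; case: ifPn => // /src_tgt_prev s.
  by rewrite s in nt.
have [s _|s /= nt] := boolP (src a b); first by rewrite (HE a b) s opprB addrC subrK.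
rewrite F0 // (HE a b) (negbTE s) subr0 HE; case: ifPn => // /src_tgt_prev s'.
by rewrite s' in nt.
Qed.

(* Dually, increasing recursion on the second index. *)
Lemma dpair_solve_down F : (forall a b, ~~ tgt a b -> F a b = 0) ->
  (forall a b, tgt a b -> src a b.+1) ->
  exists2 H, (forall a b, ~~ src a b -> H a b = 0) &
    forall a b, (a < dX t)%N -> F a b = dpair H a b.
Proof.
move=> F0 tS.
pose H a b := nat_rect (fun=> nat -> k) (fun=> 0)
  (fun b r a => if src a b.+1 then F a b + (if a is a'.+1 then r a' else 0) else 0) b a.
have HE a b : H a b.+1 = if src a b.+1 then F a b + (if a is a'.+1 then H a' b else 0) else 0.
  by [].
have H0 a b : ~~ src a b -> H a b = 0.
  by case: b => // b /negbTE s; rewrite HE s.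
exists H => // a b at_; rewrite /dpair HE; case: ifPn => s; first by rewrite addrK.
rewrite F0; last by apply: contra s; apply: tS.
case: a at_ s => [|a] at_ s; first by rewrite subrr.
rewrite H0 ?subrr //; apply: contra s => s.
by apply/tS/src_tgt_next.
Qed.

Local Notation mX := (Delta_module k stdJ).
Local Notation mY := (Delta_module k stdK).

Lemma dpair_coboundary fa fb h F H :
  (forall i, fa i = @coba k X Y h i) ->
  (forall j, fb j = @cobb k X Y h j + nmx F (dX j.+2) (dY j)) ->
  (forall a b, ~~ src a b -> H a b = 0) ->
  (forall a b, (a < dX t)%N -> F a b = dpair H a b) ->
  ext_coboundary fa fb.
Proof.
move=> ha hb H0 FH; have [na nb] := coba_nmx H0.
pose n i : 'M_(rdim X i, rdim Y i) := nmx H (dX i) (dY i).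
have [da db] := cobaD h n.
exists (fun i => h i + n i); split=> i; first by rewrite [RHS]da [coba n i]na addr0 ha.
rewrite [RHS]db [cobb n i]nb hb; congr (_ + _); apply/matrixP=> a b; rewrite !mxE.
apply: FH; apply: leq_trans (ltn_ord a) _; apply: delta_dim_mono.
by have := delta_dim_le (ltn_ord a); rewrite leqnn andbT.
Qed.

Lemma Ext1_zero_down : (forall a b, tgt a b -> src a b.+1) -> Ext1_zero t X Y.
Proof.
move=> tS; apply/(Ext1_zeroE mX mY) => fa fb /cocycle_nf[h [F [ha hb F0]]].
have [H H0 FH] := dpair_solve_down F0 tS.
exact: dpair_coboundary ha hb H0 FH.
Qed.

Lemma Ext1_zero_up : (forall a b, tgt a b -> (0 < a)%N && src a.-1 b) ->
  Ext1_zero t X Y.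
Proof.
move=> tS; apply/(Ext1_zeroE mX mY) => fa fb /cocycle_nf[h [F [ha hb F0]]].
have [H H0 FH] := dpair_solve_up F0.
apply: (dpair_coboundary ha hb H0) => a b _; apply: FH.
by case: (boolP (tgt a b)) => [/tS ->|]; rewrite ?orbT.
Qed.

(** Neither neighbour of (p, q) is a source, so [dpair H] vanishes there for every admissible H and
    E_(p,q) is no coboundary. The upward recursion solves all other target pairs, so F minus [F p q]
    times E_(p,q) is a coboundary. *)
Lemma Ext1_iso_k_up p q : (1 < t)%N -> tgt p q -> ~~ src p q.+1 ->
  ~~ ((0 < p)%N && src p.-1 q) ->
  (forall a b, tgt a b -> (a == p) && (b == q) || (0 < a)%N && src a.-1 b) ->
  Ext1_iso_k t X Y.
Proof.
move=> t1 tpq s1 s2 tS.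
pose E a b : k := ((a == p) && (b == q))%:R.
have E0 a b : ~~ tgt a b -> E a b = 0.
  by rewrite /E; case: andP => // -[/eqP-> /eqP->]; rewrite tpq.
exists (fun=> 0), (fun j => nmx E (dX j.+2) (dY j)); split.
- by apply/(ext_cocycleE _ _ mX mY); apply: cocycle_nmx.
- case=> h [h0 hE]; have [|H H0 hH] := @coba0_nmx h; first by move=> i; symmetry; apply: h0.
  have [_ nb] := coba_nmx H0.
  have Et : t.-2.+2 = t by lia.
  have /tgtP[pt /(_ t.-2)] := tpq; rewrite Et => /(_ (leqnn t) pt) qt.
  have := congr1 (fun A => entry A p q) (hE t.-2).
  rewrite /= !hH [X in _ = entry X _ _ -> _]nb !entry_matrix Et pt qt /=.
  rewrite /E !eqxx /dpair H0 // sub0r; case: p s2 {tpq s1 pt tS E E0 hE} => [|p] /= s2.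
    by rewrite oppr0 => /eqP; rewrite oner_eq0.
  by rewrite H0 // oppr0 => /eqP; rewrite oner_eq0.
move=> ga gb /(ext_cocycleE _ _ mX mY) /cocycle_nf[h [F [ha hb F0]]].
have [H H0 FH] := dpair_solve_up F0.
exists (F p q).
apply: (@dpair_coboundary _ _ h (fun a b => F a b - F p q * E a b) H) => // [i|j|a b _].
- by rewrite scaler0 subr0 ha.
- rewrite hb -addrA; congr (_ + _); apply/matrixP=> a b; rewrite !mxE //.
rewrite /E; case: andP => [[/eqP-> /eqP->]|/andP ne].
  rewrite mulr1 subrr /dpair H0 // sub0r; case: p s2 {tpq s1 tS E E0} => [|p] /= s2.
    by rewrite oppr0.
  by rewrite H0 // oppr0.
rewrite mulr0 subr0; apply: FH.
by case: (boolP (tgt a b)) => [/tS|_]; [rewrite (negbTE ne) => /= -> | rewrite orbT].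
Qed.

End DeltaExt.

(** A map lowering the filtration by 2 is strictly triangular: target pairs have b <= a - 1, and
    then E_(a-1,b) preserves the filtration. *)
Lemma Ext1_zero_self (k : fieldType) t J :
  (1 < t)%N -> standard t J -> Ext1_zero t (Delta k t J) (Delta k t J).
Proof.
move=> t1 std; apply: Ext1_zero_up => // a b /tgtP[at_ H].
have [[|j] jt [_ dj djS]] := delta_dim_jump (leqnn t) at_.
  (* If e_a appears at vertex 1 it lies in V_2, and the target condition at j = 0 would send it into
     V_0 = 0. *)
  by have := H 0%N; have := @delta_dim_mono t J 1 2; rewrite !delta_dim0; lia.
have bj : (b < a)%N.
  have := H j jt; have := @delta_dim_mono t J j j.+1; lia.
rewrite (leq_ltn_trans _ bj) //=; apply/srcP; split=> [|i it]; lia.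
Qed.

(* What the argument uses of J = J(d) and K = K(d) when e(d) = 1, with b = b_1. *)
Record split_at (t b : nat) (J K : pred nat) : Prop := SplitAt {
  split_lt : (b.+2 <= t)%N;
  split_gt0 : (0 < b)%N;
  split_Kb : K b;
  split_KbS : ~~ K b.+1;
  split_disj : forall j, K j -> ~~ J j;
  split_J : forall j, (0 < j <= t)%N ->
    J j = (j < b)%N && (odd j != odd b) || (b.+2 <= j)%N && (odd j == odd b) }.

(** * The Ext groups between Delta(J) and Delta(K) around b *)

Section SplitAt.
Variables (k : fieldType) (t b : nat) (J K : pred nat).
Hypothesis sp : split_at t b J K.
Local Notation dJ := (delta_dim t J).
Local Notation dK := (delta_dim t K).

(** J fills one parity class below b and the other from b + 2 on; K avoids J and b + 1, so only the
    complementary classes remain. *)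
Lemma split_K j : (0 < j <= t)%N -> K j ->
  (j <= b)%N && (odd j == odd b) || (b.+3 <= j)%N && (odd j != odd b).
Proof.
move=> jt Kj; have := split_disj sp Kj; rewrite (split_J sp jt).
have: j != b.+1 by apply: contraTneq Kj => ->; apply: split_KbS sp.
lia.
Qed.

Lemma split_standard_J : standard t J.
Proof.
move=> j jt; rewrite !(split_J sp) /=; lia.
Qed.

Lemma split_standard_K : standard t K.
Proof.
move=> j jt Kj; apply/negP=> KjS.
have := split_K _ Kj; have := split_K _ KjS; rewrite /=; lia.
Qed.

Lemma split_Ext1_ST : Ext1_zero t (Delta k t K) (Delta k t J).
Proof.
apply: Ext1_zero_down; [exact: split_standard_K|exact: split_standard_J|].
move=> a c /tgtP[at_ H]; apply/srcP; split=> // i it ai.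
have [[|j] ji [Kj dj djS]] := delta_dim_jump it ai.
  have := split_lt sp; have := @delta_dim_mono t K 1 2; have := H 0%N.
  by rewrite delta_dim0; lia.
(* By parity, the predecessor of an element of K other than 1 lies in J; the dimension of Delta(J)
   grows there, which makes room for index c + 1. *)
have Jj : J j.+1.
  by have := split_K _ Kj; have := split_lt sp; rewrite (split_J sp) /=; lia.
have := H j; have := @delta_dimS t J j; rewrite Jj.
by have := @delta_dim_mono t J j.+1 i; lia.
Qed.

Lemma split_Ext1_TS : Ext1_iso_k t (Delta k t J) (Delta k t K).
Proof.
have bt := split_lt sp; have b0 := split_gt0 sp.
have KbS : dK b.+1 = dK b by rewrite delta_dimS ?(negbTE (split_KbS sp)) //; lia.
have Kb : dK b = (dK b.-1).+1.
  by rewrite -{1}(prednK b0) delta_dimS ?prednK ?(split_Kb sp) //; lia.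
have KbSS : dK b.+2 = dK b.
  rewrite delta_dimS // KbS; case E: (K b.+2); last by rewrite addn0.
  by have := split_K _ E; lia.
have JbS : dJ b.+1 = dJ b.
  by rewrite delta_dimS ?(split_J sp) //; lia.
have JbSS : dJ b.+2 = (dJ b).+1.
  by rewrite delta_dimS // JbS (split_J sp) //; lia.
have Jb : dJ b = dJ b.-1.
  by rewrite -{1}(prednK b0) delta_dimS ?prednK ?(split_J sp) //; lia.
(* Counting from 0, these are the indices of b + 2 in J and of b in K. The pair (p, q + 1) fails at
   vertex b + 2, since K misses b + 1 and b + 2; the pair (p - 1, q) fails at b - 1, where e_q is
   not yet present. *)
apply: (@Ext1_iso_k_up _ _ _ _ split_standard_J split_standard_K (dJ b) (dK b).-1).
- lia.
- apply/tgtP; split=> [|j jt aj].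
    by have := @delta_dim_mono t J b.+2 t; lia.
  have bj : (b <= j)%N.
    by case: leqP => // jb; have := @delta_dim_mono t J j.+2 b.+1; lia.
  by have := @delta_dim_mono t K b j; lia.
- by apply/srcP=> -[_ /(_ b.+2 bt)]; lia.
- by apply/negP=> /andP[p0 /srcP[_ /(_ b.-1)]]; lia.
move=> a c /tgtP[at_ H]; rewrite orbC.
have [j jt [Jj dj djS]] := delta_dim_jump (leqnn t) at_.
(* Here i is the vertex where e_(a-1) appears; if e_c is already present at i, then E_(a-1,c)
   preserves the filtrations. *)
have key i : (0 < i <= t)%N -> J i -> dJ i = a -> (c < dK i)%N ->
    (0 < a)%N && src t J K a.-1 c.
  case: i => // i /andP[_ it] Ji di ci.
  have := @delta_dimS t J i it; rewrite Ji /= di => di'.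
  rewrite di' addn1 /=; apply/srcP; split=> [|i' it' ai']; first lia.
  have ii' : (i < i')%N.
    by case: leqP => // ii'; have := @delta_dim_mono t J i' i; lia.
  by have := @delta_dim_mono t K i.+1 i'; lia.
have := split_J sp (jt : (0 < j.+1 <= t)%N); rewrite Jj /= => Jj'.
(* Consecutive elements of J are two apart, except for the step from b - 1 to b + 2. At b + 2 an
   index c other than q is already present at b - 1; elsewhere the target condition applies at the
   preceding element of J. *)
have [Ej|nj] := eqVneq j b.+1.
  have Ea : a = dJ b by rewrite -dj Ej JbS.
  have cb : (c < dK b)%N by apply: H => //; lia.
  rewrite Ea eqxx /=; case: eqVneq => [|cn]; first by rewrite orbT.
  have b1 : (0 < b.-1)%N by case: (posnP b.-1) => // E; move: Kb; rewrite E delta_dim0; lia.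
  by rewrite orbF -Ea (key b.-1) //; [|rewrite (split_J sp)| |]; lia.
case: j => [|[|j]] in jt Jj dj djS Jj' nj *.
- by have := H 0%N; have := @delta_dim_mono t J 1 2; rewrite delta_dim0; lia.
- by have := H 0%N; rewrite delta_dim0; lia.
have NJ : J j.+2 = false by rewrite (split_J sp) //; lia.
have Jj1 : J j.+1 by rewrite (split_J sp) //; lia.
have d1 : dJ j.+1 = a by move: dj; rewrite delta_dimS ?NJ ?addn0 //; lia.
by rewrite (key j.+1) //; [lia | apply: H; rewrite ?djS].
Qed.

End SplitAt.

(** * Thin dimension vectors with a single even internal string *)

Lemma split_at_thin d : thin d -> e_of d = 1%N ->
  exists b, split_at (size d) b (J_of d) (K_of d).
Proof.
case/and4P=> d0 d1 dt _ /eqP; rewrite /e_of; case E: (bpos d) => [|b [|]] // _.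
have : b \in bpos d by rewrite E mem_seq1.
rewrite mem_filter => /andP[/and5P[b0 bt db dbS _] _].
(* The entry of d at b + 1 is zero while d_t = 1, so b + 1 differs from t. *)
have bt2 : (b.+2 <= size d)%N.
  rewrite ltn_neqAle bt andbT; apply: contraNneq dbS => ->; exact: dt.
(* With a single b_1 the middle clause of J(d) ranges over nothing, and as b > 0 the parity of b - 1
   is opposite to that of b. *)
have JE j : (0 < j <= size d)%N ->
    J_of d j = (j < b)%N && (odd j != odd b) || (b.+2 <= j)%N && (odd j == odd b).
  by rewrite /J_of E /=; lia.
exists b; split=> //.
- by rewrite /K_of /supp db JE; lia.
- by rewrite /K_of /supp (negbTE dbS).
- by move=> j /andP[].
Qed.

Theorem theorem4p2 (k : closedFieldType) (d : seq bool) :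
  thin d -> e_of d = 1%N ->
  let t := size d in
  let T := Delta k t (J_of d) in
  let S := Delta k t (K_of d) in
  (Ext1_iso_k t T S /\ Ext1_zero t S T) /\
  (forall (M : rep k) (f : forall i, 'M[k]_(rdim S i, rdim M i))
          (g : forall i, 'M[k]_(rdim M i, rdim T i)),
      is_module t M -> ses f g -> ~ ses_split S g ->
      Ext1_zero t M M).
Proof.
move=> thin_d e1 t T S; have [b sp] := split_at_thin thin_d e1.
have TS : Ext1_iso_k t T S := split_Ext1_TS k sp.
have ST : Ext1_zero t S T by apply: split_Ext1_ST sp.
have t1 : (1 < t)%N by have := split_lt sp; have := split_gt0 sp; lia.
have stdJ := split_standard_J sp; have stdK := split_standard_K sp.
split=> // M f g mM fg; apply: (Ext1_zero_extension _ mM _ fg) => //.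
- exact: Delta_module.
- exact: Delta_module.
- exact: Ext1_zero_self.
- exact: Ext1_zero_self.
Qed.
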